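(* Let $r\ge 0$, $t\ge 0$ and $\ell\ge 1$ be integers. If a graph $G$ is an $r$-shallow minor of $H\boxtimes P\boxtimes K_\ell$, where $H$ is a graph of treewidth at most $t$ and $P$ is a path, then $G$ is contained in $J\boxtimes P\boxtimes K_{\ell(2r+1)^2}$ for some graph $J$ with treewidth at most $\binom{2r+1+t}{t}-1$, and thus the row treewidth of $G$ satisfies $\mathrm{rtw}(G)\le \binom{2r+1+t}{t}\ell(2r+1)^2-1$.
   Context: All graphs are finite, simple and undirected. A graph $G$ is contained in $G'$ if $G$ is isomorphic to a subgraph of $G'$. The strong product $G_1\boxtimes G_2$ has vertex set $V(G_1)\times V(G_2)$, with distinct $(a,v),(b,u)$ adjacent iff ($ab\in E(G_1)$ and $u=v$) or ($a=b$ and $uv\in E(G_2)$) or ($ab\in E(G_1)$ and $uv\in E(G_2)$). $K_\ell$ is the complete graph on $\ell$ vertices. A model of $G$ in $G'$ assigns to each $v\in V(G)$ a connected subgraph $\mu(v)$ of $G'$, pairwise vertex-disjoint, such that for every edge $vw\in E(G)$ some edge of $G'$ joins $\mu(v)$ and $\mu(w)$; $G$ is an $r$-shallow minor of $G'$ if there is a model with every $\mu(v)$ of radius at most $r$. The row treewidth $\mathrm{rtw}(G)$ is the minimum treewidth of a graph $H'$ such that $G$ is contained in $H'\boxtimes P'$ for some path $P'$. *)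

(* Defs.v *)
From mathcomp Require Import all_boot.
Set Implicit Arguments. Unset Strict Implicit. Unset Printing Implicit Defensive.

Record sgraph := SGraph {
  svert :> finType;
  sadj : rel svert;
  sadj_sym : symmetric sadj;
  sadj_irr : irreflexive sadj }.

Definition strong_adj (G1 G2 : sgraph) : rel (G1 * G2)%type :=
  fun x y => (x != y) &&
    [|| (sadj x.1 y.1 && (x.2 == y.2)),
        ((x.1 == y.1) && sadj x.2 y.2) |
        (sadj x.1 y.1 && sadj x.2 y.2)].

Lemma strong_adj_sym G1 G2 : symmetric (@strong_adj G1 G2).
Proof.
move=> x y; rewrite /strong_adj eq_sym (eq_sym x.1) (eq_sym x.2).
by rewrite (sadj_sym _ x.1) (sadj_sym _ x.2).
Qed.

Lemma strong_adj_irr G1 G2 : irreflexive (@strong_adj G1 G2).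
Proof. by move=> x; rewrite /strong_adj eqxx. Qed.

Definition strong (G1 G2 : sgraph) : sgraph :=
  SGraph (@strong_adj_sym G1 G2) (@strong_adj_irr G1 G2).

Definition path_adj (n : nat) : rel 'I_n :=
  fun i j => (i.+1 == j :> nat) || (j.+1 == i :> nat).

Lemma path_adj_sym n : symmetric (@path_adj n).
Proof. by move=> i j; rewrite /path_adj orbC. Qed.

Lemma path_adj_irr n : irreflexive (@path_adj n).
Proof. by move=> i; rewrite /path_adj orbb; apply/negP => /eqP H; exact: (n_Sn _ (esym H)). Qed.

Definition path_graph (n : nat) : sgraph :=
  SGraph (@path_adj_sym n) (@path_adj_irr n).

Definition complete_adj (l : nat) : rel 'I_l := fun i j => i != j.

Lemma complete_adj_sym l : symmetric (@complete_adj l).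
Proof. by move=> i j; rewrite /complete_adj eq_sym. Qed.

Lemma complete_adj_irr l : irreflexive (@complete_adj l).
Proof. by move=> i; rewrite /complete_adj eqxx. Qed.

Definition complete (l : nat) : sgraph :=
  SGraph (@complete_adj_sym l) (@complete_adj_irr l).

Definition contained (G G' : sgraph) : Prop :=
  exists f : G -> G', injective f /\
    forall x y, sadj x y -> sadj (f x) (f y).

Definition acyclic (T : finType) (e : rel T) : Prop :=
  forall s : seq T, uniq s -> 3 <= size s -> ~~ cycle e s.

Definition is_tree (T : finType) (e : rel T) : Prop :=
  [/\ symmetric e, irreflexive e, 0 < #|T|,
      (forall x y, connect e x y) & acyclic e].

Definition tree_decomposition (G : sgraph) (T : finType) (e : rel T)
    (B : T -> {set G}) : Prop :=
  [/\ is_tree e,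
      (forall v : G, exists t, v \in B t),
      (forall u v : G, sadj u v -> exists t, (u \in B t) && (v \in B t)) &
      (forall (v : G) (t1 t2 : T), v \in B t1 -> v \in B t2 ->
         connect [rel x y | e x y && (v \in B x) && (v \in B y)] t1 t2)].

Definition tw_le (G : sgraph) (k : nat) : Prop :=
  exists (T : finType) (e : rel T) (B : T -> {set G}),
    tree_decomposition e B /\ forall t, #|B t| <= k.+1.

Definition rtw_le (G : sgraph) (k : nat) : Prop :=
  exists (H' : sgraph) (n : nat), tw_le H' k /\ contained G (strong H' (path_graph n)).

Definition within_dist (G : sgraph) (S : {set G}) (c x : G) (r : nat) : Prop :=
  exists p : seq G, [/\ size p <= r,
    path [rel a b | sadj a b && (a \in S) && (b \in S)] c p & last c p = x].

Definition shallow_minor (G G' : sgraph) (r : nat) : Prop :=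
  exists mu : G -> {set G'},
  [/\ (forall v w : G, v != w -> [disjoint mu v & mu w]),
      (forall v : G, forall x y, x \in mu v -> y \in mu v ->
          connect [rel a b | sadj a b && (a \in mu v) && (b \in mu v)] x y),
      (forall v : G, exists2 c, c \in mu v &
          forall x, x \in mu v -> within_dist (mu v) c x r) &
      (forall v w : G, sadj v w ->
          exists x y, [/\ x \in mu v, y \in mu w & sadj x y])].

(* Main.v *)
(* Root the tree of a width-[t] decomposition [B] of [H] and let [lev] order V(H)
   by the depth of the top bag.  Sharing a bag is then a chordal relation, with
   perfect elimination order given by decreasing [lev], and at most
   C(s + t, t) vertices are reachable from a given one by upward walks of length
   at most [s].  Replacing each bag by everything its elements reach upward in
   [2r] steps keeps the tree decomposition valid, and since a bag lies in the
   closed up-neighbourhood of its lowest vertex, the new bags have size at most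
   C(2r + 1 + t, t); [J] is the graph whose edges are the pairs sharing a new bag.

   Send [v] to a vertex [(x, i, k)] of its branch set with [x] as high as possible.
   If [v] and [w] are adjacent, some edge of the product joins their branch sets;
   its ends project to a common bag [B c], and the two chosen [x]'s are reached
   upward from them in [2r] steps, hence share a bag of [J].  The path coordinates
   differ by at most [q = 4r + 1], so cutting the path into blocks of length [q]
   and storing [k] and the position in the block in the complete factor,
   [l q <= l (2r + 1)^2], embeds [G]. *)
Require Import Defs.
From mathcomp Require Import all_boot.
From mathcomp Require Import zify.
Set Implicit Arguments. Unset Strict Implicit. Unset Printing Implicit Defensive.

(** * Upward walks in a perfect elimination order *)

Section UpwardReach.
Variable V : finType.
Implicit Types (up : rel V) (x y z w : V).

Fixpoint reach up s x : {set V} :=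
  if s is s'.+1 then x |: \bigcup_(y | up x y) reach up s' y else [set x].

Lemma reach_refl up s x : x \in reach up s x.
Proof. by case: s => [|s] /=; rewrite !inE ?eqxx. Qed.

Lemma reach_step up s x y z :
  up x y -> z \in reach up s y -> z \in reach up s.+1 x.
Proof.
by move=> xy zy /=; rewrite !inE; apply/orP; right; apply/bigcupP; exists y.
Qed.

Lemma reach0E up x y : (y \in reach up 0 x) = (y == x).
Proof. by rewrite inE. Qed.

Lemma reachSP up s x z : z \in reach up s.+1 x ->
  z = x \/ exists2 y, up x y & z \in reach up s y.
Proof.
by rewrite /= !inE => /orP[/eqP ->|/bigcupP[y xy zy]]; [left|right; exists y].
Qed.

Lemma reachS up s x z : z \in reach up s x -> z \in reach up s.+1 x.
Proof.
elim: s x => [|s IH] x; first by rewrite reach0E => /eqP ->; apply: reach_refl.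
case/reachSP=> [->|[y xy /IH]]; [exact: reach_refl|exact: reach_step].
Qed.

Lemma reachW up s s' x z : s <= s' -> z \in reach up s x -> z \in reach up s' x.
Proof.
move=> /subnK <-; elim: (s' - s) => // k IH zx; exact/reachS/IH.
Qed.

Definition ranked (lev : V -> nat) up := forall x y, up x y -> lev y < lev x.

(** For a [ranked] relation this is the perfect elimination property. *)
Definition chordal up :=
  forall x y z, up x y -> up x z -> [\/ y = z, up y z | up z y].

(** Compare the first step [y] with [w]. If [y] lies below [w], it again has [w] as up-neighbour and
    induction applies; otherwise the rest of the walk can be started from [w]. *)
Lemma reach_below lev up w : ranked lev up -> chordal up ->
  let up' := [rel x y | up x y && (lev w < lev y)] in
  forall s x z, up x w -> z \in reach up s x ->
  z \in reach up' s x \/ z \in reach up s w.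
Proof.
move=> rk ch up'; elim=> [|s IH] x z xw.
  by rewrite reach0E => /eqP ->; left.
case/reachSP=> [->|[y xy zy]]; first by left; apply: reach_refl.
case: (ch _ _ _ xy xw) => [eyw|yw|wy]; first by right; apply: reachS; rewrite -eyw.
  case: (IH _ _ yw zy) => H; last by right; apply: reachS.
  by left; apply: reach_step H; rewrite /up' /= xy rk.
by right; apply: reach_step zy.
Qed.

(* Let [w] be the highest up-neighbour of [z].  A walk from [z] to a vertex not
   below [w] can be rerouted through [w] at its first step; the walks staying
   below [w] live in a graph where every up-degree has dropped by one.  This is
   Pascal's rule. *)
Lemma card_reach (lev : V -> nat) up s t z : ranked lev up -> chordal up ->
  (forall u, connect up z u -> #|[set y | up u y]| <= t) ->
  #|reach up s z| <= 'C(s + t, t).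
Proof.
elim: s up t z => [|s IHs] up t z rk ch; first by rewrite cards1 bin_gt0 add0n.
elim: t up rk ch => [|t IHt] up rk ch deg.
  rewrite bin0 -(cards1 z); apply/subset_leq_card/subsetP => y /reachSP.
  case=> [->|[x zx _]]; rewrite ?inE //.
  have := deg z (connect0 _ _); rewrite leqn0 cards_eq0 => /eqP/setP/(_ x).
  by rewrite !inE zx.
have [w0 zw0|none] := pickP (up z); last first.
  apply: (@leq_trans #|[set z]|); last by rewrite cards1 bin_gt0 leq_addl.
  apply/subset_leq_card/subsetP => y /reachSP.
  by case=> [->|[x]]; rewrite ?none ?inE.
case: (arg_minnP lev zw0) => w zw wmin.
pose up' := [rel x y | up x y && (lev w < lev y)].
have rk' : ranked lev up' by move=> x y /andP[/rk].
have ch' : chordal up'.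
  move=> x y y' /andP[xy wy] /andP[xy' wy'].
  by case: (ch _ _ _ xy xy') => ?; [apply: Or31|apply: Or32|apply: Or33] => //; apply/andP.
(* By chordality [w] stays an up-neighbour all along the walk, so [up'] removes one up-neighbour
   from each vertex met. *)
have below_w x p : up x w -> path up' x p -> up (last x p) w.
  elim: p x => //= y p IHp x xw /andP[/andP[xy wy]]; apply: IHp.
  case: (ch _ _ _ xy xw) => [eyw||/rk]; [by rewrite eyw ltnn in wy|by []|].
  by rewrite ltnNge ltnW.
have deg' u : connect up' z u -> #|[set y | up' u y]| <= t.
  move=> zu; suff uw : up u w.
    have/deg : connect up z u.
      by apply: connect_sub zu => a b /andP[ab _]; apply: connect1.
    rewrite (cardsD1 w) inE uw add1n ltnS; apply: leq_trans.
    apply/subset_leq_card/subsetP => y; rewrite !inE => /andP[-> wy].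
    by rewrite andbT; apply: contraTneq wy => ->; rewrite ltnn.
  by case/connectP: zu => p pz ->; apply: below_w.
have sub : reach up s.+1 z \subset reach up' s.+1 z :|: reach up s w.
  apply/subsetP => y /reachSP[->|[x zx yx]]; first by rewrite inE reach_refl.
  rewrite inE; apply/orP.
  case: (ch _ _ _ zx zw) => [exw|xw|/rk]; first by right; rewrite -exw.
    case: (reach_below rk ch xw yx) => H; last by right.
    by left; apply: reach_step H; rewrite /= zx rk.
  by rewrite ltnNge wmin.
rewrite addnS binS addnC.
apply: leq_trans (subset_leq_card sub) _; apply: leq_trans (leq_card_setU _ _) _.
apply: leq_add; first exact: IHt.
rewrite addSnnS; apply: IHs => // u wu; apply: deg.
exact: connect_trans (connect1 zw) wu.
Qed.

(** The first step [q] from [p] equals [a], lies above [a] and is then also a step from [a], or lies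
    below [a], where induction applies. *)
Lemma reach_overtake lev up k p a x : ranked lev up -> chordal up ->
  up p a -> lev x <= lev a -> x \in reach up k p -> x \in reach up k a.
Proof.
move=> rk ch; elim: k p => [|k IH] p pa xa.
  by rewrite reach0E => /eqP exp; move/rk: pa; rewrite -exp ltnNge xa.
case/reachSP=> [exp|[q pq xq]]; first by move/rk: pa; rewrite -exp ltnNge xa.
case: (ch _ _ _ pq pa) => [<-|qa|aq]; first exact: reachS.
  exact/reachS/(IH q).
exact: reach_step xq.
Qed.

(** Built from the end of the walk: a downward step from [a] to [b] is bypassed by [reach_overtake],
    as [a] is an up-neighbour of [b]. *)
Lemma reach_walk (lev : V -> nat) (S : rel V) :
  symmetric S -> injective lev ->
  let up := [rel x y | S x y && (lev y < lev x)] in chordal up ->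
  forall p a, path S a p -> all (fun y => lev (last a p) <= lev y) (a :: p) ->
  last a p \in reach up (size p) a.
Proof.
move=> Ssym inj up ch; have rk : ranked lev up by move=> x y /andP[].
elim=> [|b p IH] a /=; first by rewrite inE.
case/andP=> Sab /IH{}IH /andP[la lb]; move/(_ lb): IH => IH.
case: (ltngtP (lev b) (lev a)) => [ba|ab|/inj <-]; last exact: reachS.
  by apply: reach_step IH; rewrite /= Sab.
by apply/reachS/(reach_overtake rk ch _ la IH); rewrite /= Ssym Sab.
Qed.

End UpwardReach.

(** * Rooted trees and the elimination order *)

Section Trees.
Variables (T : finType) (e : rel T).
Hypothesis tree_e : is_tree e.

Let avoid c := [rel x y | [&& e x y, x != c & y != c]].

(** A path from [a] to [b] off [c] would close to a cycle through [c]. *)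
Lemma acyclic_branches c a b :
  e c a -> e c b -> connect (avoid c) a b -> a = b.
Proof.
case: tree_e => esym eirr _ _ acyc ca cb /connectP[p0 path0 lastb].
case/shortenP: path0 lastb => p pathp up _ lastb.
apply/eqP/negPn/negP => nab.
have pc : c \notin a :: p.
  rewrite inE negb_or; apply/andP; split.
    by apply: contraTneq ca => ->; rewrite eirr.
  elim: p a pathp {up lastb nab ca} => //= d p IH a /andP[/and3P[_ _ dc] /IH].
  by rewrite inE negb_or eq_sym dc.
have := acyc (c :: a :: p); rewrite cons_uniq pc up => /(_ isT).
case: p pathp lastb {up pc} => [_ /= ba|d p pathp lastb]; first by rewrite ba eqxx in nab.
move/(_ isT)/negP; apply.
rewrite (cycle_path c) /= -/(last d p) in lastb *.
rewrite -lastb esym cb ca /=.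
by have/= := sub_path _ pathp; apply => x y /and3P[].
Qed.

(** [d] is the distance from the root; [y] is the penultimate vertex of a shortest walk. *)
Lemma tree_depth : exists (root : T) (d : T -> nat),
  d root = 0 /\
  (forall x, x != root -> exists2 y, e y x & d y < d x).
Proof.
case: tree_e => esym _ /card_gt0P[root _] conn _; exists root.
have ex x : exists k, [exists p : k.-tuple T, path e root p && (last root p == x)].
  case/connectP: (conn root x) => p pp lx; exists (size p).
  by apply/existsP; exists (in_tuple p); rewrite pp -lx /=.
exists (fun x => ex_minn (ex x)); split=> [|x xr].
  case: ex_minnP => k _ /(_ 0) k0; apply/eqP; rewrite -leqn0; apply: k0.
  by apply/existsP; exists [tuple]; rewrite /=.
 case: (ex_minnP (ex x)) => k /existsP[[p sp] /= /andP[pp /eqP lx]] _.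
case/lastP: p => [|p y] in sp pp lx *; first by rewrite -lx eqxx in xr.
move: pp lx; rewrite rcons_path last_rcons => /andP[pp ey] eyx.
exists (last root p); first by rewrite -eyx.
case: ex_minnP => m _ /(_ (size p)) H.
have {}H: m <= size p.
  by apply: H; apply/existsP; exists (in_tuple p); rewrite pp /=.
by rewrite -(eqP sp) size_rcons ltnS.
Qed.

End Trees.

(* The ordering is by depth of the top bag [c] of [x]: the bags of a [y] that is
   not lower than [x] meet those of [x] and also leave the subtree below [c], so
   they contain [c]. *)
Lemma treedec_elimination (G : sgraph) (T : finType) (e : rel T) (B : T -> {set G}) :
  tree_decomposition e B -> exists lev : G -> nat,
  injective lev /\
  forall x, exists c, forall y c', x \in B c' -> y \in B c' -> lev y <= lev x ->
    y \in B c.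
Proof.
case=> tree_e cov _ conB; have [esym eirr _ _ _] := tree_e.
have [root [d [d0 dpar]]] := tree_depth tree_e.
have exc x : exists c, (x \in B c) && [forall c', (x \in B c') ==> (d c <= d c')].
  have [c0 xc0] := cov x; case: (@arg_minnP _ c0 (fun c => x \in B c) d xc0) => c xc cmin.
  by exists c; rewrite xc; apply/forallP => c'; apply/implyP/cmin.
pose top x := xchoose (exc x).
have topB x : x \in B (top x) by case/andP: (xchooseP (exc x)).
have topmin x c : x \in B c -> d (top x) <= d c.
  by case/andP: (xchooseP (exc x)) => _ /forallP/(_ c)/implyP.
(* Ties in depth are broken by [enum_rank], for injectivity. *)
pose lev x := d (top x) * #|G| + enum_rank x.
have levmod x : lev x %% #|G| = enum_rank x by rewrite /lev modnMDl modn_small.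
have levdiv x : lev x %/ #|G| = d (top x).
  by rewrite /lev divnMDl ?divn_small ?addn0 //; apply/card_gt0P; exists x.
exists lev; split=> [x y exy|x].
  by apply/enum_rank_inj/val_inj; rewrite /= -!levmod exy.
exists (top x) => y s xs ys leyx; set c := top x.
have dyx : d (top y) <= d c by rewrite -!levdiv leq_div2r.
apply/negPn/negP => ync.
pose avoid := [rel a b | [&& e a b, a != c & b != c]].
have avoidC : connect_sym avoid.
  by apply: sym_connect_sym => a b /=; rewrite esym [(a != c) && _]andbC.
have inBy z : y \in B z -> z != c by apply: contraTneq => ->.
(* Depth strictly drops on the way up, so the walk never meets [c]. *)
have to_root z : z != c -> d z <= d c -> connect avoid root z.
  have [m] := ubnP (d z); elim: m z => // m IH z dm zc dz.
  have [->//|zr] := eqVneq z root.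
  have [z' ez dz'] := dpar _ zr.
  have z'c : z' != c by apply: contraTneq dz' => ->; rewrite -leqNgt.
  apply: connect_trans (IH z' _ _ _) (connect1 _) => //.
  - exact: leq_trans dz' _.
  - exact: leq_trans (ltnW dz') dz.
  - by rewrite /= ez z'c.
have rc : c != root.
  apply/eqP => cr; have tyr : top y != root by rewrite -cr inBy.
  by have [z _] := dpar _ tyr; rewrite ltnNge (leq_trans dyx) // cr d0.
have [b eb db] := dpar _ rc.
have bc : b != c by apply: contraTneq db => ->; rewrite ltnn.
(* [a] follows [c] on a path to [s] through bags of [x]. *)
have [a ea [xa as_]] : exists2 a, e c a & x \in B a /\ connect avoid a s.
  case/connectP: (conB x c s (topB x) xs) => p0 pp0 ls.
  case/shortenP: pp0 ls => p pp up _ ls.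
  case: p pp up ls => [|a p] /=; first by move=> _ _ sc; rewrite -sc ys in ync.
  case/andP=> /andP[/andP[ca _] xa] pp /andP[cp _] ls; exists a => //; split=> //.
  apply/connectP; exists p => //.
  elim: p a pp cp {ca xa ls} => //= z p IH a /andP[/andP[/andP[az _] _] pp].
  rewrite !inE !negb_or => /and3P[ca cz cp].
  by rewrite az ![_ == c]eq_sym ca cz IH // inE negb_or cz.
(* [T - c] connects [a] to [b] through [s], [top y] and the root. *)
have ab : a = b.
  apply: (acyclic_branches tree_e ea); first by rewrite esym.
  apply: connect_trans as_ _; rewrite -/avoid.
  apply: (@connect_trans _ _ (top y)).
    apply: connect_sub (conB y s (top y) ys (topB y)) => u v /andP[/andP[uv yu] yv].
    by apply: connect1; rewrite /= uv !inBy.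
  apply: (@connect_trans _ _ root); last exact/to_root/ltnW.
  by rewrite avoidC; apply: to_root => //; apply: inBy.
(* So [b] contains [x] and is shallower than its top bag [c]. *)
by have := topmin _ _ xa; rewrite -/c ab leqNgt db.
Qed.

(** * The graph generated by a family of bags *)

Section BagGraph.
Variables (V T : finType) (e : rel T) (B : T -> {set V}).

(** Loops are allowed, so that a walk in a product still projects to a walk when the coordinate
    stands still. *)
Definition share : rel V := fun x y => [exists c, (x \in B c) && (y \in B c)].

Lemma shareP x y : reflect (exists2 c, x \in B c & y \in B c) (share x y).
Proof.
by apply: (iffP existsP) => [[c /andP[]]|[c xc yc]]; exists c; rewrite ?xc.
Qed.

Lemma share_sym : symmetric share.
Proof. by move=> x y; apply: eq_existsb => c; rewrite andbC. Qed.

Definition bag_adj : rel V := fun x y => (x != y) && share x y.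

Lemma bag_adj_sym : symmetric bag_adj.
Proof. by move=> x y; rewrite /bag_adj eq_sym share_sym. Qed.

Lemma bag_adj_irr : irreflexive bag_adj.
Proof. by move=> x; rewrite /bag_adj eqxx. Qed.

Definition bag_graph := SGraph bag_adj_sym bag_adj_irr.

Lemma bag_graph_treedec : is_tree e -> (forall v, exists c, v \in B c) ->
  (forall v c1 c2, v \in B c1 -> v \in B c2 ->
     connect [rel x y | e x y && (v \in B x) && (v \in B y)] c1 c2) ->
  @tree_decomposition bag_graph T e B.
Proof. by move=> tree_e cov conB; split=> // u v /andP[_ /existsP]. Qed.

End BagGraph.

(** * Bags enlarged by upward reach *)

Section Spread.
Variables (G : sgraph) (T : finType) (e : rel T) (B : T -> {set G}).
Variable lev : G -> nat.
Hypothesis decB : tree_decomposition e B.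
Hypothesis lev_inj : injective lev.
Hypothesis elim_lev : forall x, exists c,
  forall y c', x \in B c' -> y \in B c' -> lev y <= lev x -> y \in B c.

Definition upward : rel G := fun x y => share B x y && (lev y < lev x).

(** Source of both chordality and the bound on up-degrees. *)
Lemma upward_bag x : exists2 c, x \in B c & forall y, upward x y -> y \in B c.
Proof.
have [_ cov _ _] := decB; have [c cP] := elim_lev x; have [c0 xc0] := cov x.
exists c => [|y /andP[/shareP[c' xc' yc'] /ltnW yx]]; first exact: (cP _ _ xc0).
exact: (cP _ _ xc').
Qed.

Lemma upward_ranked : ranked lev upward.
Proof. by move=> x y /andP[]. Qed.

Lemma upward_chordal : chordal upward.
Proof.
move=> x y z xy xz; have [c _ cP] := upward_bag x.
have yz : share B y z by apply/shareP; exists c; apply: cP.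
case: (ltngtP (lev y) (lev z)) => [lt|lt|/lev_inj]; last exact: Or31.
  by apply: Or33; rewrite /upward share_sym yz.
by apply: Or32; rewrite /upward yz.
Qed.

Definition spread s c : {set G} := \bigcup_(y in B c) reach upward s y.

(** Along the upward walk from [y] to [x], the bags of each vertex are connected and have [x] in
    their spread; consecutive vertices share a bag. *)
Lemma spread_connect s x y c1 c2 k : k <= s ->
  x \in reach upward k y -> y \in B c1 -> x \in B c2 ->
  connect [rel a b | e a b && (x \in spread s a) && (x \in spread s b)] c1 c2.
Proof.
have [_ _ _ conB] := decB; move=> ks.
have lift z j c c' : j <= s -> x \in reach upward j z -> z \in B c -> z \in B c' ->
    connect [rel a b | e a b && (x \in spread s a) && (x \in spread s b)] c c'.
  move=> js xz zc zc'; apply: connect_sub (conB z c c' zc zc') => a b.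
  case/andP=> /andP[ab za] zb; apply: connect1; rewrite /= ab.
  by apply/andP; split; apply/bigcupP; exists z => //; apply: reachW js xz.
elim: k y c1 ks => [|k IH] y c1 ks.
  by rewrite reach0E => /eqP <-; apply: (lift x 0); rewrite ?reach_refl.
case/reachSP=> [<-|[q yq xq] yc1 xc2]; first by apply: (lift x 0); rewrite ?reach_refl.
have /andP[/shareP[c yc qc] _] := yq.
apply: connect_trans (IH q c (ltnW ks) xq qc xc2).
by apply: (lift y k.+1) => //; apply: reach_step xq.
Qed.

Lemma spread_treedec s : @tree_decomposition (bag_graph (spread s)) T e (spread s).
Proof.
have [[esym eirr T0 conn acyc] cov _ _] := decB.
apply: bag_graph_treedec => // [v|v c1 c2 /bigcupP[y yc vy] /bigcupP[z zc vz]].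
  by have [c vc] := cov v; exists c; apply/bigcupP; exists v; rewrite ?reach_refl.
have [c0 vc0] := cov v; pose R := [rel a b | e a b && (v \in spread s a) && (v \in spread s b)].
have symR : connect_sym R.
  by apply: sym_connect_sym => a b /=; rewrite esym -!andbA [(v \in _) && _]andbC.
apply: (connect_trans (spread_connect (leqnn s) vy yc vc0)).
rewrite -/R symR; exact: spread_connect vz zc vc0.
Qed.

Lemma card_spread s t c : (forall c, #|B c| <= t.+1) ->
  #|spread s c| <= 'C(s.+1 + t, t).
Proof.
move=> wB; have [B0|[z0 z0c]] := set_0Vmem (B c).
  by rewrite /spread B0 big_set0 cards0.
(* All other vertices of the bag are up-neighbours of [z], which costs one extra step. *)
case: (@arg_maxnP _ z0 (fun z => z \in B c) lev z0c) => z zc zmax.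
apply: (@leq_trans #|reach upward s.+1 z|).
  apply/subset_leq_card/bigcupsP => y yc; apply/subsetP => x xy.
  have := zmax y yc; rewrite /= leq_eqVlt => /orP[/eqP/lev_inj eyz|yz].
    by apply: reachS; rewrite -eyz.
  apply: reach_step xy; rewrite /upward yz andbT.
  by apply/shareP; exists c.
apply: (card_reach _ upward_ranked upward_chordal) => u _.
have [c' uc' cP] := upward_bag u.
rewrite -ltnS; apply: leq_trans (wB c'); rewrite (cardsD1 u (B c')) uc' ltnS.
apply/subset_leq_card/subsetP => y; rewrite !inE => uy; rewrite cP // andbT.
by apply: contraTneq uy => ->; rewrite /upward ltnn andbF.
Qed.

Lemma spread_walk s x p : path (share B) x p -> size p <= s ->
  all (fun y => lev (last x p) <= lev y) (x :: p) ->
  last x p \in reach upward s x.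
Proof.
move=> pp ps lp; apply: reachW ps _.
exact: (reach_walk (share_sym B) lev_inj upward_chordal).
Qed.

End Spread.

(** * Containment and treewidth of strong products *)

Lemma contained_trans (G1 G2 G3 : sgraph) :
  contained G1 G2 -> contained G2 G3 -> contained G1 G3.
Proof.
move=> [f [fi fh]] [g [gi gh]]; exists (g \o f); split; first exact: inj_comp.
by move=> x y /fh/gh.
Qed.

Lemma strong_adjP (G1 G2 : sgraph) (x y : strong G1 G2) : sadj x y ->
  (x.1 = y.1 \/ sadj x.1 y.1) /\ (x.2 = y.2 \/ sadj x.2 y.2).
Proof.
rewrite /= /strong_adj => /andP[_].
by case/or3P=> /andP[]; [move=> ? /eqP|move/eqP|]; auto.
Qed.

Lemma strong_adjI (G1 G2 : sgraph) (x y : strong G1 G2) : x != y ->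
  (x.1 == y.1) || sadj x.1 y.1 -> (x.2 == y.2) || sadj x.2 y.2 -> sadj x y.
Proof.
case: x y => [x1 x2] [y1 y2] nxy; rewrite /= /strong_adj nxy /=.
move: nxy; rewrite xpair_eqE.
by case: (x1 == y1); case: (x2 == y2); case: (sadj x1 y1); case: (sadj x2 y2).
Qed.

Lemma tw_strong_complete (G : sgraph) k m : 0 < m -> tw_le G k ->
  tw_le (strong G (complete m)) (k.+1 * m - 1).
Proof.
move=> m0 [T [e [B [[tree_e cov edges conB] wB]]]].
exists T, e, (fun c => setX (B c) setT); split; last first.
  by move=> c; rewrite cardsX cardsT card_ord subn1 prednK ?muln_gt0 // leq_mul2r wB orbT.
split=> // [[v i]|[u i] [v j] /strong_adjP[/= uv _]|[v i] c1 c2].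
- by have [c vc] := cov v; exists c; rewrite !inE vc.
- case: uv => [->|/edges[c /andP[uc vc]]].
    by have [c vc] := cov v; exists c; rewrite !inE vc.
  by exists c; rewrite !inE uc vc.
rewrite !inE !andbT => vc1 vc2; apply: connect_sub (conB v _ _ vc1 vc2) => a b ab.
by apply: connect1; rewrite /= !inE !andbT.
Qed.

(** Puts the clique beside [G], to be absorbed into the factor of bounded treewidth. *)
Lemma strong_rot (G P K : sgraph) :
  contained (strong (strong G P) K) (strong (strong G K) P).
Proof.
exists (fun x => ((x.1.1, x.2), x.1.2)); split.
  by move=> [[a b] c] [[a' b'] c'] [-> -> ->].
move=> [[a b] c] [[a' b'] c'] xy; have nxy : (a, b, c) != (a', b', c').
  by apply: contraTneq xy => ->; rewrite sadj_irr.
case/strong_adjP: xy => /= ab cc; have [aa bb] : (a = a' \/ sadj a a') /\ (b = b' \/ sadj b b').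
  by case: ab => [[-> ->]|/strong_adjP]; auto.
apply: strong_adjI => /=.
- by apply: contraNneq nxy => -[-> -> ->].
- case: eqVneq => //= nac; apply: strong_adjI => //=.
    by case: aa => [->|->]; rewrite ?eqxx ?orbT.
  by case: cc => [->|->]; rewrite ?eqxx ?orbT.
by case: bb => [->|->]; rewrite ?eqxx ?orbT.
Qed.

(** * Walks inside branch sets *)

Lemma shallow_walk (G : sgraph) (S : {set G}) c r x y : c \in S ->
  (forall x, x \in S -> within_dist S c x r) -> x \in S -> y \in S ->
  exists p, [/\ size p <= 2 * r, path (@sadj G) x p, all (mem S) (x :: p) & last x p = y].
Proof.
move=> cS near xS yS; have [p [sp pp lp]] := near x xS; have [q [sq pq lq]] := near y yS.
have inS z s : z \in S -> path [rel a b | sadj a b && (a \in S) && (b \in S)] z s ->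
    all (mem S) (z :: s) /\ path (@sadj G) z s.
  elim: s z => [|b s IH] z zS /=; first by rewrite zS.
  by case/andP=> /andP[/andP[-> _] bS] /(IH _ bS)[/= -> ->]; rewrite zS.
have [aq aqp] := inS _ _ cS pq; have [ap app] := inS _ _ cS pp.
have last_rev : last x (rev (belast c p)) = c.
  by case: (p) lp => [|d p'] /= lp; [rewrite lp|rewrite rev_cons last_rcons].
(* Back from [x] to the centre [c], then out to [y]. *)
exists (rev (belast c p) ++ q); split.
- by rewrite size_cat size_rev size_belast mul2n -addnn leq_add.
- rewrite cat_path last_rev aqp andbT -lp rev_path.
  by rewrite (eq_path (e' := @sadj G)) // => a b; apply: sadj_sym.
- rewrite -cat_cons all_cat; apply/andP; split; last by case/andP: aq.
  have -> : x :: rev (belast c p) = rev (c :: p) by rewrite (lastI c p) lp rev_rcons.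
  by rewrite all_rev.
- by rewrite last_cat last_rev.
Qed.

(** Each step moves the path coordinate by at most one. *)
Lemma walk_levels (H : sgraph) n l (x : strong (strong H (path_graph n)) (complete l)) p :
  path (@sadj _) x p ->
  x.1.2 <= (last x p).1.2 + size p /\ (last x p).1.2 <= x.1.2 + size p.
Proof.
elim: p x => [|y p IH] x /=; first by rewrite addn0.
case/andP=> /strong_adjP[xy _] /IH[].
have [lo hi] : x.1.2 <= y.1.2.+1 /\ y.1.2 <= x.1.2.+1.
  case: xy => [->|/strong_adjP[_ [->|]]] //.
  by rewrite /= /path_adj => /orP[]/eqP <-; rewrite leqnn !leqW.
move=> lo' hi'; split.
  by apply: leq_trans lo _; rewrite addnS ltnS.
by apply: leq_trans hi' _; rewrite addnS -addSn leq_add2r.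
Qed.

(** * Embedding of the shallow minor *)

Theorem theorem11 (r t l : nat) (hl : 1 <= l) (G H : sgraph) (n : nat) :
  tw_le H t ->
  shallow_minor G (strong (strong H (path_graph n)) (complete l)) r ->
  (exists J : sgraph,
      tw_le J ('C(2 * r + 1 + t, t) - 1) /\
      contained G (strong (strong J (path_graph n))
                          (complete (l * (2 * r + 1) ^ 2))))
  /\ rtw_le G ('C(2 * r + 1 + t, t) * l * (2 * r + 1) ^ 2 - 1).
Proof.
move=> [T [e [B [decB wB]]]] minorG.
have C0 : 0 < 'C(2 * r + 1 + t, t) by rewrite bin_gt0 leq_addl.
have m0 : 0 < l * (2 * r + 1) ^ 2 by rewrite muln_gt0 hl expn_gt0 addn1.
suff [J [twJ GJ]] : exists J : sgraph, tw_le J ('C(2 * r + 1 + t, t) - 1) /\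
    contained G (strong (strong J (path_graph n)) (complete (l * (2 * r + 1) ^ 2))).
  split; first by exists J.
  exists (strong J (complete (l * (2 * r + 1) ^ 2))), n; split.
    by have := tw_strong_complete m0 twJ; rewrite -subSn // subSS subn0 mulnA.
  exact: contained_trans GJ (strong_rot _ _ _).
have [lev [lev_inj elim_lev]] := treedec_elimination decB.
exists (bag_graph (spread B lev (2 * r))); split.
  exists T, e, (spread B lev (2 * r)); split; first exact: spread_treedec.
  by move=> c; rewrite subn1 prednK // addn1; apply: (card_spread decB lev_inj).
case: minorG => mu [disj _ near edge].
have [tree_e cov edgeB _] := decB.
have exrep v : exists y, (y \in mu v) && [forall x in mu v, lev y.1.1 <= lev x.1.1].
  have [c cv _] := near v.
  case: (@arg_minnP _ c (fun y => y \in mu v) (fun y => lev y.1.1) cv) => y yv ymin.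
  by exists y; rewrite yv; apply/forall_inP.
pose rep v := xchoose (exrep v).
have repP v : rep v \in mu v by case/andP: (xchooseP (exrep v)).
have repmin v x : x \in mu v -> lev (rep v).1.1 <= lev x.1.1.
  by case/andP: (xchooseP (exrep v)) => _ /forall_inP; apply.
have rep_inj : injective rep.
  move=> v w evw; apply/eqP/negPn/negP => /disj/pred0P/(_ (rep v)) /=.
  by rewrite {2}evw !repP.
have walk v x y : x \in mu v -> y \in mu v -> exists p,
    [/\ size p <= 2 * r, path (@sadj _) x p, all (mem (mu v)) (x :: p) & last x p = y].
  by move=> xv yv; have [c cv nearc] := near v; apply: shallow_walk cv nearc xv yv.
have shareB x y : x = y \/ sadj x y -> share B x y.
  case=> [<-|/edgeB[c /andP[xc yc]]]; last by apply/shareP; exists c.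
  by have [c xc] := cov x; apply/shareP; exists c.
(* A walk in the branch set, projected to [H], ends at its highest vertex, so [spread_walk]
   applies. *)
have rep_reach v x : x \in mu v -> (rep v).1.1 \in reach (upward B lev) (2 * r) x.1.1.
  move=> xv; have [p [sp pp ap lp]] := walk v x (rep v) xv (repP v).
  have lp' : last x.1.1 [seq z.1.1 | z <- p] = (rep v).1.1.
    by rewrite (last_map (fun z => z.1.1)) lp.
  rewrite -lp'; apply: (spread_walk decB lev_inj) => //; last 2 first.
  - by rewrite size_map.
  - rewrite lp' -(map_cons (fun z => z.1.1)) all_map.
    by apply: sub_all ap => z /repmin.
  apply: (homo_path (f := fun z => z.1.1)) pp => a b /strong_adjP[ab _].
  by apply: shareB; case: ab => [->|/strong_adjP[]]; auto.
(* Two walks of length at most [2r] and the edge between the branch sets. *)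
pose q := 4 * r + 1.
have q0 : 0 < q by rewrite /q addn1.
have close v w : sadj v w -> (rep v).1.2 %/ q <= ((rep w).1.2 %/ q).+1.
  case/edge=> x [y [xv yw xy]].
  have [p [sp pp _ lp]] := walk v x (rep v) xv (repP v).
  have [s [ss ps _ ls]] := walk w y (rep w) yw (repP w).
  have [_] := walk_levels pp; rewrite lp => pv.
  have [sw _] := walk_levels ps; rewrite ls in sw.
  have xy1 : path (@sadj _) x [:: y] by apply/andP.
  have [xy2 _] := walk_levels xy1.
  apply: (@leq_trans (((rep w).1.2 + q) %/ q)).
    by apply: leq_div2r; move: pv sw xy2 sp ss; rewrite /q /=; lia.
  by rewrite divnDr // divnn q0 addn1.
have i_lt v : (rep v).1.2 %/ q < n by apply: leq_ltn_trans (leq_div _ _) (ltn_ord _).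
(* Clique index and block position form a two-digit number in base [q]; it fits since
   [4r + 1 <= (2r + 1)^2]. *)
have k_lt v : (rep v).2 * q + (rep v).1.2 %% q < l * (2 * r + 1) ^ 2.
  have : (rep v).2 * q + (rep v).1.2 %% q < l * q.
    apply: (@leq_trans ((rep v).2.+1 * q)); last by rewrite leq_mul2r ltn_ord orbT.
    by rewrite mulSn addnC ltn_add2r ltn_mod.
  move/leq_trans; apply; rewrite leq_mul2l; apply/orP; right; rewrite /q; nia.
pose f v : strong (strong (bag_graph (spread B lev (2 * r))) (path_graph n))
    (complete (l * (2 * r + 1) ^ 2)) :=
  (((rep v).1.1, Ordinal (i_lt v)), Ordinal (k_lt v)).
have f_inj : injective f.
  (* The digits of the last coordinate and the block index recover [rep v]. *)
  move=> v w [e1 e2 e3]; apply: rep_inj.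
  have mods : (rep v).1.2 %% q = (rep w).1.2 %% q.
    by move/(congr1 (modn^~ q)): e3; rewrite !modnMDl !modn_mod.
  have e4 : (rep v).2 = (rep w).2.
    apply: val_inj; move/eqP: e3; rewrite mods eqn_add2r eqn_pmul2r //.
    by move/eqP.
  have e5 : (rep v).1.2 = (rep w).1.2.
    by apply: val_inj; rewrite /= (divn_eq (rep v).1.2 q) e2 mods -divn_eq.
  by case: (rep v) (rep w) e1 e4 e5 => [[? ?] ?] [[? ?] ?] /= -> -> ->.
exists f; split=> // v w vw.
have nvw : v != w by apply: contraTneq vw => ->; rewrite sadj_irr.
have nf : f v != f w by rewrite (inj_eq f_inj).
apply: strong_adjI => //; last by rewrite /= /complete_adj; case: eqVneq.
have [//|nf1] := eqVneq (f v).1 (f w).1; rewrite orFb; apply: strong_adjI => //.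
  rewrite /= /bag_adj; case: eqVneq => //= _.
  have [x [y [xv yw /strong_adjP[xy _]]]] := edge _ _ vw.
  have /shareP[c xc yc] : share B x.1.1 y.1.1.
    by apply: shareB; case: xy => [->|/strong_adjP[]]; auto.
  by apply/shareP; exists c; apply/bigcupP; [exists x.1.1|exists y.1.1] => //; apply: rep_reach.
rewrite /= /path_adj -val_eqE /=.
have := close _ _ vw; have : sadj w v by rewrite sadj_sym.
by move/close; lia.
Qed.
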